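(* Let $k\ge 1$ and let $\mathcal{C}$ be the intersection of $k$ partition matroids $\mathcal{M}_1,\dots,\mathcal{M}_k$ on the same finite ground set $V$. Then $$\chi_\ell(\mathcal{C})\le k\max_{1\le i\le k}\chi(\mathcal{M}_i).$$
   Context: A complex on a finite set $V$ is a non-empty family of subsets of $V$ closed under taking subsets; its members are called faces. A matroid is identified with the complex of its independent sets. Given a partition $(P_1,\dots,P_m)$ of $V$, the associated partition matroid is the family of all subsets of $V$ meeting each $P_i$ in at most one element. The intersection of matroids is the complex of sets independent in all of them. The chromatic number $\chi(\mathcal{C})$ of a complex $\mathcal{C}$ on $V$ is the minimum number of faces of $\mathcal{C}$ whose union is $V$. Given sets (lists) $L_v$ of permissible colors for $v\in V$, a $\mathcal{C}$-respecting list coloring is a function $f:V\to\bigcup_{v}L_v$ with $f(v)\in L_v$ for every $v\in V$ and $f^{-1}(c)\in\mathcal{C}$ for every color $c$. The list chromatic number $\chi_\ell(\mathcal{C})$ is the minimum $p$ such that every system of lists $(L_v)_{v\in V}$ with $|L_v|=p$ for all $v$ has a $\mathcal{C}$-respecting list coloring. *)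

(* Defs.v *)
From mathcomp Require Import all_boot finmap.
From mathcomp Require Import boolp.

Set Implicit Arguments.
Unset Strict Implicit.
Unset Printing Implicit Defensive.

Record complex (V : finType) := Complex {
  faces :> {set {set V}};
  complex_neq0 : faces != set0;
  complex_sub : forall A B : {set V}, A \subset B -> B \in faces -> A \in faces
}.

(* P is meant to be a partition of V, in the sense of [finset.partition]; that
   hypothesis is not needed for the family to be a complex. *)
Definition partition_matroid_faces (V : finType) (P : {set {set V}}) :
  {set {set V}} := [set A | [forall B in P, #|A :&: B| <= 1]].

Lemma partition_matroid_neq0 (V : finType) (P : {set {set V}}) :
  partition_matroid_faces P != set0.
Proof.
apply/set0Pn; exists set0; rewrite inE; apply/forall_inP => B _.
by rewrite set0I cards0.
Qed.

Lemma partition_matroid_sub (V : finType) (P : {set {set V}})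
    (A B : {set V}) : A \subset B ->
  B \in partition_matroid_faces P -> A \in partition_matroid_faces P.
Proof.
move=> sAB; rewrite !inE => /forall_inP hB; apply/forall_inP => D DP.
by apply: leq_trans (hB D DP); apply/subset_leq_card/setSI.
Qed.

Definition partition_matroid (V : finType) (P : {set {set V}}) : complex V :=
  Complex (partition_matroid_neq0 P) (@partition_matroid_sub V P).

Definition intersection_faces (V : finType) (k : nat) (M : 'I_k -> complex V) :
  {set {set V}} := [set A | [forall i, A \in faces (M i)]].

Lemma complex_set0 (V : finType) (C : complex V) : set0 \in faces C.
Proof.
by have /set0Pn[A fA] := complex_neq0 C; apply: complex_sub fA; apply: sub0set.
Qed.

Lemma intersection_neq0 (V : finType) (k : nat) (M : 'I_k -> complex V) :
  intersection_faces M != set0.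
Proof.
apply/set0Pn; exists set0; rewrite inE; apply/forallP => i.
exact: complex_set0.
Qed.

Lemma intersection_sub (V : finType) (k : nat) (M : 'I_k -> complex V)
    (A B : {set V}) : A \subset B ->
  B \in intersection_faces M -> A \in intersection_faces M.
Proof.
move=> sAB; rewrite !inE => /forallP hB; apply/forallP => i.
exact: complex_sub sAB (hB i).
Qed.

Definition intersection (V : finType) (k : nat) (M : 'I_k -> complex V) :
  complex V := Complex (intersection_neq0 M) (@intersection_sub V k M).

(* The minimum of a set of naturals, with value 0 on the empty set. That value
   is never used for intersections of partition matroids: see
   [chromatic_number_spec] and [list_chromatic_number_spec]. *)
Definition least (P : nat -> Prop) : nat :=
  if pselect (exists n, `[< P n >]) is left h then ex_minn h else 0.

Definition coverable (V : finType) (C : complex V) (n : nat) : Prop :=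
  exists Q : {set {set V}},
    [/\ Q \subset faces C, cover Q = [set: V] & #|Q| = n].

Definition chromatic_number (V : finType) (C : complex V) : nat :=
  least (coverable C).

Definition respecting_list_coloring (V : finType) (C : complex V)
    (K : choiceType) (L : V -> {fset K}) (f : V -> K) : Prop :=
  (forall v, f v \in L v) /\ (forall c, [set v | f v == c] \in faces C).

Definition list_colorable (V : finType) (C : complex V) (p : nat) : Prop :=
  forall (K : choiceType) (L : V -> {fset K}),
    (forall v, #|` L v| = p) -> exists f, respecting_list_coloring C L f.

Definition list_chromatic_number (V : finType) (C : complex V) : nat :=
  least (list_colorable C).

Lemma least_spec (P : nat -> Prop) : (exists n, P n) ->
  P (least P) /\ forall m, P m -> least P <= m.
Proof.
move=> [n Pn]; rewrite /least; case: pselect => [h|[]]; last first.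
  by exists n; apply/asboolP.
case: ex_minnP => m /asboolP Pm hm; split=> // j Pj; apply: hm.
exact/asboolP.
Qed.

Definition loopless (V : finType) (C : complex V) : Prop :=
  forall v, [set v] \in faces C.

Lemma loopless_intersection (V : finType) (k : nat) (M : 'I_k -> complex V) :
  (forall i, loopless (M i)) -> loopless (intersection M).
Proof. by move=> h v; rewrite inE; apply/forallP => i; apply: h. Qed.

Lemma loopless_partition_matroid (V : finType) (P : {set {set V}}) :
  loopless (partition_matroid P).
Proof.
move=> v; rewrite inE; apply/forall_inP => B _.
by rewrite -(cards1 v); apply/subset_leq_card/subsetIl.
Qed.

Lemma chromatic_number_spec (V : finType) (C : complex V) : loopless C ->
  coverable C (chromatic_number C) /\
  forall n, coverable C n -> chromatic_number C <= n.
Proof.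
move=> lC; apply: least_spec; exists #|[set [set v] | v : V]|.
exists [set [set v] | v : V]; split=> //.
  by apply/subsetP => _ /imsetP[v _ ->].
apply/setP => v; rewrite inE; apply/bigcupP; exists [set v]; last exact: set11.
exact: imset_f.
Qed.

Lemma list_chromatic_number_spec (V : finType) (C : complex V) : loopless C ->
  list_colorable C (list_chromatic_number C) /\
  forall p, list_colorable C p -> list_chromatic_number C <= p.
Proof.
move=> lC; apply: least_spec; exists #|V| => K L cL.
have base : exists f : V -> K, forall v, f v \in L v.
  have /fin_all_exists [f hf] : forall v, exists c, c \in L v.
    move=> v; apply/fset0Pn; rewrite -cardfs_gt0 cL.
    by apply/card_gt0P; exists v.
  by exists f.
have step (s : seq V) : uniq s ->
    exists f : V -> K, (forall v, f v \in L v) /\ {in s &, injective f}.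
  elim: s => [_|x s IHs /= /andP[xs us]].
    by have [f hf] := base; exists f.
  have [f [fL fI]] := IHs us.
  have [c cx cs] : exists2 c, c \in L x & c \notin [seq f v | v <- s].
    apply: contrapT => h.
    have sub : {subset L x <= [seq f v | v <- s]}.
      by move=> c cx; apply: contrapT => /negP fc; apply: h; exists c.
    have := uniq_leq_size (fset_uniq (L x)) sub.
    rewrite size_map -(card_uniqP us).
    have -> : size (L x) = #|V| by exact: cL.
    rewrite leqNgt; suff -> : #|s| < #|V| by [].
    have uxs : uniq (x :: s) by rewrite /= xs.
    by have := max_card (mem (x :: s)); rewrite (card_uniqP uxs) (card_uniqP us).
  exists (fun v : V => if v == x then c else f v); split.
    by move=> v; case: eqP => [->|].
  have neq v : v \in s -> f v != c.
    by move=> vs; apply: contraNneq cs => <-; apply: map_f.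
  move=> u v; rewrite !inE.
  case: eqP => [->|_] /=; case: eqP => [->|_] //= hu hv.
  - by move=> e; have := neq v hv; rewrite -e eqxx.
  - by move=> e; have := neq u hu; rewrite e eqxx.
  - exact: fI.
have [f [fL fI]] := step _ (enum_uniq V).
exists f; split=> // c.
have [[v /eqP fv]|h] := pselect (exists v, f v == c); last first.
  rewrite (_ : [set v | _] = set0) ?complex_set0 //.
  by apply/setP => v; rewrite !inE; apply/negP => e; apply: h; exists v.
apply: complex_sub (lC v); apply/subsetP => u; rewrite !inE -fv => /eqP e.
by apply/eqP/fI; rewrite ?mem_enum.
Qed.

(* Main.v *)
Require Import Defs.
From mathcomp Require Import all_boot finmap.

(** Let D be the largest of the chromatic numbers. A face of a partition
matroid takes at most one element from each part, so every part has at most D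
elements ([card_part_le_chromatic_number]). Call two distinct elements of V
adjacent when they share a part of one of the k partitions: a colouring
respects the intersection as soon as it is proper for this graph. The k parts
through v have at most k D elements altogether and, as k > 0, one of these
elements is v itself; so v has fewer than k D neighbours, and lists of size
k D suffice to colour V greedily ([greedy_list_coloring]). *)

Set Implicit Arguments.
Unset Strict Implicit.
Unset Printing Implicit Defensive.

(** Colouring the vertices one at a time, the neighbours of the current vertex
forbid at most one colour each, hence never exhaust its list. *)
Lemma greedy_list_coloring (V : finType) (K : choiceType) (e : rel V)
    (L : V -> {fset K}) :
  symmetric e -> (forall v, #|[set w | e v w] :\ v| < #|` L v|) ->
  exists f : V -> K, (forall v, f v \in L v) /\
    (forall u v, e u v -> f u = f v -> u = v).
Proof.
move=> e_sym degL.
have step (s : seq V) : exists f : V -> K, (forall v, f v \in L v) /\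
    {in s &, forall u v, e u v -> f u = f v -> u = v}.
  elim: s => [|x s [f [fL fP]]].
    have /fin_all_exists [f fL] : forall v, exists c, c \in L v.
      by move=> v; apply/fset0Pn; rewrite -cardfs_gt0; apply: leq_trans (degL v).
    by exists f.
  pose forbidden := [seq f w | w <- enum ([set w | e x w] :\ x)].
  have [c cL cN] : exists2 c, c \in L x & c \notin forbidden.
    apply/allPn/negP => /allP sub.
    have := uniq_leq_size (fset_uniq (L x)) sub.
    by rewrite size_map -cardE leqNgt degL.
  have fresh w : e x w -> w != x -> f w != c.
    move=> exw wx; apply: contraNneq cN => <-.
    by apply: map_f; rewrite mem_enum !inE wx.
  exists (fun v => if v == x then c else f v); split.
    by move=> v; case: eqP => [->|].
  move=> u v; rewrite !inE.
  have [->|ux] := eqVneq u x; have [->|vx] //= := eqVneq v x.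
  - by move=> _ _ /fresh/(_ vx)/eqP h /esym.
  - by move=> _ _; rewrite e_sym => /fresh/(_ ux)/eqP h.
  - exact: fP.
have [f [fL fP]] := step (enum V).
by exists f; split=> // u v; apply: fP; rewrite mem_enum.
Qed.

(** Each face of a cover of V contributes at most one element to B. *)
Lemma card_part_le_chromatic_number (V : finType) (P : {set {set V}})
    (B : {set V}) :
  B \in P -> #|B| <= chromatic_number (partition_matroid P).
Proof.
move=> BP.
have [[Q [/subsetP Qfaces Qcover <-]] _] :=
  chromatic_number_spec (loopless_partition_matroid P).
have -> : B = \bigcup_(A in Q) (A :&: B).
  by rewrite -big_distrl /= -/(cover Q) Qcover setTI.
rewrite -sum1_card; apply: leq_trans (_ : \sum_(A in Q) #|A :&: B| <= _).
  rewrite sum1_card; elim/big_rec2: _ => [|A n U _ IH]; first by rewrite cards0.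
  by apply: leq_trans (leq_card_setU _ _) _; rewrite leq_add2l.
rewrite -sum1_card; apply: leq_sum => A /Qfaces.
by rewrite inE => /forall_inP; apply.
Qed.

Theorem corollary6p3 (V : finType) (k : nat) (hk : 1 <= k)
    (P : 'I_k -> {set {set V}}) (hP : forall i, partition (P i) [set: V]) :
  list_chromatic_number (intersection (fun i => partition_matroid (P i)))
    <= k * \max_(i < k) chromatic_number (partition_matroid (P i)).
Proof.
have loopless_matroids i : loopless (partition_matroid (P i)).
  exact: loopless_partition_matroid.
have [_] := list_chromatic_number_spec (loopless_intersection loopless_matroids).
apply=> K L sizeL.
set D := \max_(i < k) _ in sizeL.
pose e : rel V := fun u v => [exists i, v \in pblock (P i) u].
have in_cover i v : v \in cover (P i) by rewrite (cover_partition (hP i)) inE.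
have e_refl v : e v v.
  by apply/existsP; exists (Ordinal hk); rewrite mem_pblock in_cover.
have e_sym : symmetric e.
  move=> u v; apply: eq_existsb => i; have trivP := partition_trivIset (hP i).
  by rewrite -!eq_pblock // eq_sym.
have card_closed_nbhd v : #|[set w | e v w]| <= k * D.
  have -> : [set w | e v w] = \bigcup_(i < k) pblock (P i) v.
    apply/setP => w; rewrite inE; apply/existsP/bigcupP => [[i]|[i _]];
      by exists i.
  apply: leq_trans (_ : \sum_(i < k) #|pblock (P i) v| <= _).
    elim/big_rec2: _ => [|i n U _ IH]; first by rewrite cards0.
    by apply: leq_trans (leq_card_setU _ _) _; rewrite leq_add2l.
  rewrite -[k in k * D]card_ord -sum_nat_const; apply: leq_sum => i _.
  apply: leq_trans (leq_bigmax i).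
  by apply: card_part_le_chromatic_number; rewrite pblock_mem.
have [|f [fL fP]] := greedy_list_coloring (L := L) e_sym.
  move=> v; rewrite sizeL; apply: leq_trans (card_closed_nbhd v).
  by rewrite [leqRHS](cardsD1 v) inE e_refl.
exists f; split=> // c; rewrite inE; apply/forallP => i; rewrite inE.
apply/forall_inP => B BP; apply/card_le1_eqP => u v.
rewrite !inE => /andP[/eqP fu uB] /andP[/eqP fv vB].
apply: fP; last by rewrite fv.
apply/existsP; exists i.
by rewrite (def_pblock (partition_trivIset (hP i)) BP vB).
Qed.
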